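(* There is a set $N \subset (1,\infty)$ which is meager and has Lebesgue measure zero such that for every real $\beta > 1$ with $\beta \notin N$, the two-sided $\beta$-shift $(X_\beta, \sigma)$ is not conjugate to its inverse $(X_\beta, \sigma^{-1})$.
   Context: The $\beta$-shift: for real $\beta > 1$, let $d_\beta: [0,1) \to \{0,\ldots,\lceil\beta\rceil - 1\}^{\mathbb{N}}$ send $x$ to the lexicographically largest sequence $x_1x_2x_3\ldots$ over $\{0,\ldots,\lceil\beta\rceil-1\}$ with $x = \sum_{n=1}^\infty x_n\beta^{-n}$. The one-sided $\beta$-shift is the closure of $d_\beta([0,1))$ in the product topology. The two-sided $\beta$-shift $X_\beta$ is the set of all bi-infinite sequences in $\{0,\ldots,\lceil\beta\rceil - 1\}^{\mathbb{Z}}$ all of whose finite subwords are subwords of some point of the one-sided $\beta$-shift. The left shift $\sigma: X_\beta \to X_\beta$, $(\sigma x)(n) = x(n+1)$, is a homeomorphism. Two topological dynamical systems $(X,T)$ and $(Y,S)$ (compact metric spaces with continuous self-maps) are conjugate if there is a continuous bijection $\varphi: X\to Y$ with $S\circ\varphi = \varphi\circ T$. *)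

(* Defs.v *)
From mathcomp Require Import all_boot all_order all_algebra.
From mathcomp Require Import all_classical all_reals all_analysis.

Set Implicit Arguments.
Unset Strict Implicit.
Unset Printing Implicit Defensive.

Import Order.TTheory GRing.Theory Num.Theory.
Import numFieldNormedType.Exports.

Local Open Scope classical_set_scope.
Local Open Scope ring_scope.

Definition nowhere_dense (T : topologicalType) (A : set T) : Prop :=
  interior (closure A) = set0.

Definition meager (T : topologicalType) (A : set T) : Prop :=
  exists2 F : nat -> set T,
    forall n, nowhere_dense (F n) & A `<=` \bigcup_n F n.

Definition conjugate (X Y : topologicalType) (T : X -> X) (S : Y -> Y) : Prop :=
  exists phi : X -> Y,
    [/\ continuous phi, bijective phi & S \o phi = phi \o T].

Lemma reindex_continuous (I : eqType) (T : topologicalType) (h : I -> I) :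
  continuous ((fun x => x \o h) : {ptws I -> T} -> {ptws I -> T}).
Proof.
move=> x; apply/cvg_sup => [|i]; first by apply: fmap_filter; exact: nbhs_filter.
apply: (@continuous_comp_initial {ptws I -> T} {ptws I -> T} T
  (fun y => y i) (fun y => y \o h)).
exact: (@proj_continuous I (fun=> T) (h i)).
Qed.

Section BetaShift.
Context {R : realType}.
Implicit Type beta : R.

(* For beta > 0 the absolute value does nothing: it only turns the integer
   ceiling into the natural number which is the size of the alphabet. *)
Definition digit beta := discrete_topology 'I_(`|Num.ceil beta|%N).

Definition one_sided_seq beta := {ptws nat -> digit beta}.
Definition two_sided_seq beta := {ptws int -> digit beta}.

(* Sequences are indexed from 0: s n is the digit x_{n+1}. *)
Definition expansion beta (x : R) (s : one_sided_seq beta) : Prop :=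
  series (fun n => (nat_of_ord (s n))%:R / beta ^+ n.+1) @ \oo --> x.

Definition lex_lt beta (s t : one_sided_seq beta) : Prop :=
  exists2 n, forall i, (i < n)%N -> s i = t i
           & (nat_of_ord (s n) < nat_of_ord (t n))%N.

(* The graph of d_beta: the sequence s is d_beta x. *)
Definition d_beta beta (x : R) (s : one_sided_seq beta) : Prop :=
  expansion x s /\ forall t, expansion x t -> t = s \/ lex_lt t s.

Definition one_sided_beta_shift beta : set (one_sided_seq beta) :=
  closure [set s | exists2 x : R, 0 <= x < 1 & d_beta x s].

Arguments one_sided_beta_shift beta _ : clear implicits.

(* The word x i, ..., x (i + k - 1) occurs in s at position j. *)
Definition two_sided_beta_shift beta : set (two_sided_seq beta) :=
  [set x | forall (i : int) (k : nat),
     exists2 s, one_sided_beta_shift beta s &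
       exists j : nat, forall m : nat, (m < k)%N -> x (i + m%:Z) = s (j + m)%N].

Arguments two_sided_beta_shift beta _ : clear implicits.

Lemma two_sided_beta_shift_translate beta (d : int) (x : two_sided_seq beta) :
  two_sided_beta_shift beta x ->
  two_sided_beta_shift beta ((fun n => x (n + d)) : two_sided_seq beta).
Proof.
move=> Xx i k; have [s Ss [j sj]] := Xx (i + d) k.
by exists s => //; exists j => m mk; rewrite addrAC sj.
Qed.

(* The set two_sided_beta_shift, coerced to a type (of dependent pairs), carries
   the subspace topology. *)
Definition translate beta (d : int) (x : two_sided_beta_shift beta) :
    two_sided_beta_shift beta :=
  SigSub (mem_set (two_sided_beta_shift_translate d (set_valP x))).

Lemma translate_continuous beta (d : int) : continuous (@translate beta d).
Proof.
apply: (continuous_comp_initial (w := set_val)).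
pose t : two_sided_seq beta -> two_sided_seq beta := fun x n => x (n + d).
have tc : continuous t by exact: reindex_continuous.
move=> x; apply: (@continuous_comp _ _ _ set_val t); last exact: tc.
exact: initial_continuous.
Qed.

Definition sigma beta : two_sided_beta_shift beta -> two_sided_beta_shift beta :=
  translate 1.
Definition sigma_inv beta :
    two_sided_beta_shift beta -> two_sided_beta_shift beta :=
  translate (-1).

Arguments sigma beta x : clear implicits.
Arguments sigma_inv beta x : clear implicits.

Lemma sigmaK beta : cancel (sigma beta) (sigma_inv beta).
Proof. by move=> x; apply/val_inj/funext => n /=; rewrite addrNK. Qed.

Lemma sigma_invK beta : cancel (sigma_inv beta) (sigma beta).
Proof. by move=> x; apply/val_inj/funext => n /=; rewrite addrK. Qed.

End BetaShift.

Arguments one_sided_beta_shift {R} beta _.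
Arguments two_sided_beta_shift {R} beta _.
Arguments sigma {R} beta x.
Arguments sigma_inv {R} beta x.

(* Main.v *)
(* A word occurs in X_b iff each of its suffixes w has value sum_j w_j b^-(j+1)
   less than 1 (two_sided_beta_shiftP). Past and future play different roles:
   - the past may determine the future: let c_n be what remains of 1 after its
     first n quasi-greedy digits e_0, ..., e_(n-1), scaled by b^n. A past ending
     with e_0 ... e_(n-1) must be followed by words of value < c_n, hence by M
     zeros if c_n < b^-M;
   - the future never determines the past: any right tail can be preceded by
     ...000 or by ...00010^(L-1), where L depends on b only.
   A conjugacy with the inverse is a reversing block code, and so is its inverse,
   so it would turn the first behaviour, for M large, into a contradiction with
   the second. Hence there is none as soon as inf c_n = 0. The exceptional set
   {b | inf c_n > 0} is a countable union of sets which are porous from the left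
   (orbit1_hole), hence nowhere dense, and null by Lebesgue's density theorem. *)
Require Import Defs.
From mathcomp Require Import all_boot all_order all_algebra.
From mathcomp Require Import all_classical all_reals all_analysis.
From mathcomp Require Import measurable_realfun ring lra zify.

Import Order.TTheory GRing.Theory Num.Theory.
Import numFieldNormedType.Exports.

Local Open Scope classical_set_scope.
Local Open Scope ring_scope.

Set Implicit Arguments.
Unset Strict Implicit.
Unset Printing Implicit Defensive.

(** * The quasi-greedy orbit of 1 as the base varies *)

Section QuasiGreedyOrbit.
Context {R : realType}.
Implicit Types (b d eps x y : R) (n : nat).

(* The orbit of 1 under [c |-> b c - (ceil (b c) - 1)], which stays in ]0, 1];
   its digits are those of the quasi-greedy b-expansion of 1. *)
Definition orbit1 b n : R :=
  iter n (fun c => b * c - (Num.ceil (b * c) - 1)%:~R) 1.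

Definition digit1 b n : int := Num.ceil (b * orbit1 b n) - 1.

Lemma orbit1S b n : orbit1 b n.+1 = b * orbit1 b n - (digit1 b n)%:~R.
Proof. by []. Qed.

Lemma orbit1_itv b n : 0 < orbit1 b n <= 1.
Proof.
case: n => [|n]; first by rewrite /orbit1 /= ltr01 lexx.
have := ceil_itv (b * orbit1 b n); rewrite orbit1S /digit1 rmorphB /=.
by move=> /andP[? ?]; apply/andP; split; lra.
Qed.

(** With the digits [e] frozen, the orbit of 1 is polynomial in the base, so orbits at nearby bases
    can be compared. *)
Fixpoint itinerary_poly (e : nat -> int) n : {poly R} :=
  if n is n'.+1 then 'X * itinerary_poly e n' - (e n')%:~R%:P else 1.

Lemma itinerary_polyS e n x :
  (itinerary_poly e n.+1).[x] = x * (itinerary_poly e n).[x] - (e n)%:~R.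
Proof. by rewrite /= !hornerE. Qed.

Lemma itinerary_poly_digit1 b n :
  (itinerary_poly (digit1 b) n).[b] = orbit1 b n.
Proof.
by elim: n => [|n IH]; [rewrite /= hornerE|rewrite itinerary_polyS IH].
Qed.

(** A value in ]0, 1] can only arise by subtracting the ceiling minus one, so frozen digits are the
    true ones as long as the iterates stay in ]0, 1]. *)
Lemma orbit1_itinerary_poly e x n :
  (forall j, (j <= n)%N -> 0 < (itinerary_poly e j).[x] <= 1) ->
  orbit1 x n = (itinerary_poly e n).[x].
Proof.
elim: n => [_|n IH H]; first by rewrite /= hornerE.
have En := IH (fun j jn => H j (leqW jn)).
have := H _ (leqnn n.+1); rewrite itinerary_polyS orbit1S /digit1 En => Hn.
suff -> : Num.ceil (x * (itinerary_poly e n).[x]) = e n + 1 by rewrite addrK.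
by apply: ceil_def; rewrite addrK intrD; move: Hn => /andP[? ?]; apply/andP; split; lra.
Qed.

(** With [p] and [q] the values at [y] and [x], y p - x q = y (p - q) + (y - x) q, so each step
    multiplies the gap by at least [y]. *)
Lemma itinerary_poly_expand e x y n : 0 <= x -> x <= y ->
  (forall j, (j <= n)%N -> 0 <= (itinerary_poly e j).[x]) ->
  y ^+ n * (y - x) <=
    (itinerary_poly e n.+1).[y] - (itinerary_poly e n.+1).[x].
Proof.
move=> x0 xy; elim: n => [_|n IH H].
  by rewrite !itinerary_polyS /= !hornerE; lra.
have := IH (fun j jn => H j (leqW jn)).
rewrite !(itinerary_polyS e n.+1); set p := _.[y]; set q := _.[x].
have q0 : 0 <= q by exact: H.
have y0 : 0 <= y by exact: le_trans xy.
move=> /(ler_wpM2l y0); have : 0 <= (y - x) * q by rewrite mulr_ge0 ?subr_ge0.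
by rewrite exprS; lra.
Qed.

Lemma itinerary_poly_le e x y n : 0 <= x -> x <= y ->
  (forall j, (j < n)%N -> 0 <= (itinerary_poly e j).[x]) ->
  (itinerary_poly e n).[x] <= (itinerary_poly e n).[y].
Proof.
case: n => [*|n x0 xy /(itinerary_poly_expand x0 xy)]; first by rewrite /= !hornerE.
move=> H; rewrite -subr_ge0; apply: le_trans H.
by rewrite mulr_ge0 ?exprn_ge0 ?subr_ge0 ?(le_trans x0).
Qed.

(** With [p] and [q] the values at [x] and [y], multiplying by the base leaves the excess t (1 - t)
    (y - x) (q - p), nonnegative by monotonicity. *)
Lemma itinerary_poly_convex e x y t n : 0 <= x -> x <= y -> 0 <= t <= 1 ->
  (forall j, (j < n)%N -> 0 <= (itinerary_poly e j).[x]) ->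
  (itinerary_poly e n).[(1 - t) * x + t * y] <=
    (1 - t) * (itinerary_poly e n).[x] + t * (itinerary_poly e n).[y].
Proof.
move=> x0 xy /andP[t0 t1]; elim: n => [_|n IH H].
  by rewrite /= !hornerE; lra.
have := IH (fun j jn => H j (leqW jn)).
have := itinerary_poly_le x0 xy (fun j jn => H j (leqW jn)).
rewrite !itinerary_polyS; set p := _.[x]; set q := _.[y]; set r := _.[_].
move=> pq rpq.
have z0 : 0 <= (1 - t) * x + t * y by nra.
have := ler_wpM2l z0 rpq.
have : 0 <= t * (1 - t) * (y - x) * (q - p).
  by rewrite !mulr_ge0 // subr_ge0.
lra.
Qed.

Lemma expr_unbounded x y : 1 < x -> exists n, y < x ^+ n.
Proof.
move=> x1; have [/ltW y0|y0] := ltP y 0.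
  by exists 0%N; rewrite expr0 (le_lt_trans y0).
have x10 : 0 < x - 1 by lra.
have bern n : 1 + n%:R * (x - 1) <= x ^+ n.
  elim: n => [|n IH]; first by rewrite expr0; lra.
  have n0 : 0 <= n%:R :> R by [].
  have : x * (1 + n%:R * (x - 1)) <= x ^+ n.+1.
    by rewrite exprS ler_wpM2l //; lra.
  have : 0 <= n%:R * (x - 1) ^+ 2 by rewrite mulr_ge0 ?sqr_ge0.
  by rewrite -natr1 expr2; lra.
have yx : 0 <= y / (x - 1) by apply: divr_ge0 => //; lra.
exists (Num.bound (y / (x - 1))).
have := archi_boundP yx; rewrite ltr_pdivrMr // => ?.
by have := bern (Num.bound (y / (x - 1))); lra.
Qed.

(* Moving the base down from [b] with the digits of [b] frozen, the first
   iterate to vanish does so at some [x0]; by convexity it stays below [d]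
   on a definite proportion of the way back from [x0] to [b]. *)
Lemma orbit1_hole b d eps : 1 < b -> (forall n, d <= orbit1 b n) -> 0 < eps ->
  exists2 x0, b - eps < x0 < b &
    forall x, x0 < x < x0 + d * (b - x0) -> exists n, orbit1 x n < d.
Proof.
move=> b1 db eps0; set p := itinerary_poly (digit1 b).
pose x1 := b - Num.min eps (b - 1) / 2.
have [x1_gt1 x1_lt x1_eps] : [/\ 1 < x1, x1 < b & b - eps < x1].
  by rewrite /x1; case: (leP eps (b - 1)) => ?; split; lra.
have x10 : 0 <= x1 by lra.
have pb n : 0 < (p n).[b] <= 1 by rewrite itinerary_poly_digit1 orbit1_itv.
(* Otherwise the gap between the values at [b] and [x1] would grow like b^n, although the former are
   at most 1 and the latter positive. *)
have exk : exists k, (p k).[x1] <= 0.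
  apply: contrapT => /forallNP H.
  have [n] := expr_unbounded (b - x1)^-1 b1.
  rewrite -[X in X < _]mul1r ltr_pdivrMr ?subr_gt0 // => bn.
  have p0 j : 0 <= (p j).[x1] by rewrite leNgt; apply/negP => /ltW; exact: H.
  have := itinerary_poly_expand x10 (ltW x1_lt) (fun j (_ : (j <= n)%N) => p0 j).
  by have := pb n.+1; have := p0 n.+1; rewrite -/p => ? /andP[_ ?]; lra.
case: (ex_minnP exk) => k pk kmin.
have pos j x : (j < k)%N -> x1 <= x -> 0 < (p j).[x].
  have pos1 i : (i < k)%N -> 0 < (p i).[x1].
    by rewrite ltNge => ik; apply/negP => /kmin; rewrite leqNgt ik.
  move=> jk x1x; apply: lt_le_trans (pos1 _ jk) _.
  by apply: itinerary_poly_le => // i ij; rewrite ltW// pos1// (ltn_trans ij).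
have /poly_ivt : (p k).[x1] <= 0 <= (p k).[b] by rewrite pk ltW//; case/andP: (pb k).
move=> /(_ (ltW x1_lt))[x0 /andP[x1x0 x0b] /rootP px0].
have x0_lt : x0 < b.
  rewrite lt_neqAle x0b andbT; apply/eqP => x0E.
  by have := pb k; rewrite -x0E px0 ltxx.
exists x0; first by apply/andP; split => //; lra.
move=> x /andP[x0x xlt].
have x00 : 0 <= x0 by lra.
have d1 : d <= 1 by exact: db 0%N.
have xb : x <= b by nra.
(* By convexity, [p k] is at most [t] at [x], as it vanishes at [x0] and is at most 1 at [b]; the
   width of the hole is chosen so that t < d. *)
pose t := (x - x0) / (b - x0).
have bx0 : 0 < b - x0 by lra.
have t0 : 0 <= t by rewrite divr_ge0 // ltW // subr_gt0.
have td : t < d by rewrite ltr_pdivrMr //; lra.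
have pj0 j : (j < k)%N -> 0 <= (p j).[x0] by move=> jk; rewrite ltW// pos.
have pkd : (p k).[x] < d.
  have tE : (1 - t) * x0 + t * b = x.
    by rewrite /t; field; rewrite gt_eqF.
  have t01 : 0 <= t <= 1 by rewrite t0 (le_trans (ltW td)).
  have := itinerary_poly_convex x00 x0b t01 pj0; rewrite tE -/p px0.
  by case/andP: (pb k) => ? ?; nra.
have pk0 : 0 < (p k).[x].
  case: k {pk kmin} pos px0 pj0 pkd => [|k] pos px0 pj0 pkd.
    by rewrite /= hornerE.
  have := itinerary_poly_expand x00 (ltW x0x) pj0.
  rewrite -/p px0 subr0 => H; apply: lt_le_trans H.
  by rewrite mulr_gt0 ?subr_gt0 // exprn_gt0 // (le_lt_trans x00).
exists k; rewrite (@orbit1_itinerary_poly (digit1 b)) // => j jk.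
rewrite -/p; apply/andP; split.
  by move: jk; rewrite leq_eqVlt => /predU1P[->|jk]//; apply: pos => //; lra.
case/andP: (pb j) => _; apply: le_trans.
apply: itinerary_poly_le => //; first lra.
by move=> i ij; rewrite ltW // pos //; [exact: leq_trans ij jk | lra].
Qed.

End QuasiGreedyOrbit.

(** * Porous sets of bases are nowhere dense and null *)

Section NullMeager.
Context {R : realType}.
Implicit Types (b d eps x : R) (A : set R).

Lemma measurable_orbit1 n : measurable_fun setT (fun b : R => orbit1 b n).
Proof.
elim: n => [|n IH]; first exact: measurable_cst.
have mM : measurable_fun setT (fun b : R => b * orbit1 b n).
  exact: measurable_funM.
apply: (measurable_funB mM).
apply: (measurableT_comp (f := fun x : R => (Num.ceil x - 1)%:~R : R) _ mM).
apply: nondecreasing_measurable => // x y xy.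
by rewrite ler_int lerD2r ceil_le.
Qed.

Lemma holes_nowhere_dense A :
  (forall b eps, A b -> 0 < eps -> exists x0 x1,
     [/\ b - eps < x0, x0 < x1, x1 <= b & forall x, x0 < x < x1 -> ~ A x]) ->
  nowhere_dense A.
Proof.
move=> hole; rewrite /nowhere_dense -subset0 => z.
have oI : open (interior (closure A)) by exact: open_interior.
move=> Iz; have [b [Ab Ib]] := interior_subset Iz _ (open_nbhs_nbhs (conj oI Iz)).
have /nbhs_ballP[eps /= eps0 be] := open_nbhs_nbhs (conj oI Ib).
have [x0 [x1 [bx0 x01 x1b nA]]] := hole _ _ Ab eps0.
pose m := (x0 + x1) / 2.
have bm : ball b eps m by rewrite /ball /= ger0_norm /m; lra.
have mI : m \in `]x0, x1[ by rewrite in_itv /= /m; apply/andP; split; lra.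
have [y [Ay]] := interior_subset (be _ bm) _ (near_in_itvoo mI).
by rewrite /= in_itv => /nA.
Qed.

(** The ball about a point [b] of [A] whose left end is [x0] misses a proportion d / 2, so [A] does
    not have density 1 at [b]. *)
Lemma porous_negligible A d : measurable A -> 0 < d -> d <= 1 ->
  (forall b eps, A b -> 0 < eps -> exists2 x0, b - eps < x0 < b &
     forall x, x0 < x < x0 + d * (b - x0) -> ~ A x) ->
  (@lebesgue_measure R).-negligible A.
Proof.
move=> mA d0 d1 hole; apply: negligibleS (lebesgue_density mA) => b Ab /=.
rewrite indicE mem_set //=; set f := fun r : R => _ => cf.
(* Any threshold strictly between 1 - d / 2 and 1 would do. *)
have d4 : ((1 - d / 4)%:E < 1%:E :> \bar R)%E by rewrite lte_fin; lra.
have := cf _ (open_ereal_gt' d4).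
move=> /nbhs_ballP[eps /= eps0 be].
have [x0 /andP[x0_gt x0_lt] nA] := hole _ _ Ab eps0.
pose r := b - x0.
have r0 : 0 < r by rewrite subr_gt0.
have : ball 0 eps r by rewrite /ball /= sub0r normrN gtr0_norm /r; lra.
move=> /be /(_ r0); rewrite /= /f; apply/negP; rewrite -leNgt.
have sub : A `&` ball b r `<=` `[x0 + d * r, b + r[%classic.
  move=> x [Ax]; rewrite /ball /= ltr_norml in_itv /= => /andP[x_gt x_lt].
  apply/andP; split; last lra.
  rewrite leNgt; apply/negP => xl; apply: (nA x) => //.
  by rewrite -/r xl andbT; rewrite /r in x_lt; lra.
have mle : (lebesgue_measure (A `&` ball b r) <= ((2 - d) * r)%:E)%E.
  have mAb : measurable (A `&` ball b r) by exact: measurableI (measurable_ball _ _).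
  have mI : measurable (`[x0 + d * r, b + r[%classic : set R) by exact: measurable_itv.
  apply: (@le_trans _ _ (lebesgue_measure (`[x0 + d * r, b + r[%classic : set R))).
    exact: (@le_measure _ _ _ (@lebesgue_measure R) _ _ (mem_set mAb) (mem_set mI) sub).
  rewrite lebesgue_measure_itv /= lte_fin ifT; last by rewrite /r; nra.
  by rewrite -EFinD lee_fin /r; lra.
rewrite lebesgue_measure_ball ?(ltW r0) // inver mulrn_eq0 /= gt_eqF //.
have i0 : (0 <= (r *+ 2)^-1%:E :> \bar R)%E by rewrite lee_fin invr_ge0 mulrn_wge0 // ltW.
apply: (le_trans (lee_wpmul2r i0 mle)).
rewrite -EFinM lee_fin (_ : (2 - d) * r / (r *+ 2) = 1 - d / 2); first lra.
by field; rewrite gt_eqF.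
Qed.

Lemma orbit1_away_from_0_small d : 0 < d -> d <= 1 ->
  let A := [set b | 1 < b /\ forall n, d <= orbit1 b n] : set R in
  nowhere_dense A /\ (@lebesgue_measure R).-negligible A.
Proof.
move=> d0 d1 A.
have hole b eps : A b -> 0 < eps -> exists2 x0, b - eps < x0 < b &
    forall x, x0 < x < x0 + d * (b - x0) -> ~ A x.
  move=> [b1 db] eps0; have [x0 x0b H] := orbit1_hole b1 db eps0.
  by exists x0 => // x /H[n xn] [_ /(_ n)]; rewrite leNgt xn.
split.
  apply: holes_nowhere_dense => b eps Ab /(hole _ _ Ab)[x0 /andP[x0l x0b] H].
  by exists x0, (x0 + d * (b - x0)); split => //; nra.
apply: porous_negligible d0 d1 hole.
rewrite (_ : A = `]1, +oo[ `&` \bigcap_n (fun b => d <= orbit1 b n) @^-1` [set true]).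
  apply: measurableI; first exact: measurable_itv.
  apply: bigcapT_measurable => n; rewrite -[X in measurable X]setTI.
  by apply: measurable_fun_ler => //; exact: measurable_orbit1.
apply/seteqP; split => b /=; rewrite in_itv /= andbT.
  by move=> [? db]; split => // n _ /=; rewrite db.
by move=> [? db]; split => // n; exact: db n I.
Qed.

End NullMeager.

(** * Values of words and greedy expansions *)

Section Words.
Context {R : realType}.
Implicit Types (b x : R) (w : nat -> nat) (y : nat -> R).

Definition word_value b w k : R := \sum_(j < k) (w j)%:R / b ^+ j.+1.

Lemma word_value_eq b w w' k : (forall j, (j < k)%N -> w j = w' j) ->
  word_value b w k = word_value b w' k.
Proof. by move=> ww'; apply: eq_bigr => j _; rewrite ww'. Qed.

Lemma word_value_cat b w m k : word_value b w (m + k) =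
  word_value b w m + word_value b (fun j => w (m + j)%N) k / b ^+ m.
Proof.
rewrite /word_value big_split_ord /= mulr_suml; congr (_ + _).
by apply: eq_bigr => j _; rewrite -addnS exprD invfM mulrA mulrAC.
Qed.

Lemma word_value1 b w : word_value b w 1 = (w 0%N)%:R / b.
Proof. by rewrite /word_value big_ord1 expr1. Qed.

Lemma word_value_ge0 b w k : 0 <= b -> 0 <= word_value b w k.
Proof. by move=> b0; apply: sumr_ge0 => j _; rewrite divr_ge0 ?exprn_ge0. Qed.

Lemma word_value_le b w m k : 0 <= b -> (m <= k)%N ->
  word_value b w m <= word_value b w k.
Proof.
move=> b0 mk; rewrite -(subnKC mk) word_value_cat lerDl.
by rewrite divr_ge0 ?word_value_ge0 ?exprn_ge0.
Qed.

Lemma word_value_zeros b w k : (forall j, (j < k)%N -> w j = 0%N) ->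
  word_value b w k = 0.
Proof. by move=> w0; apply: big1 => j _; rewrite w0 ?mul0r. Qed.

Lemma word_value_drop_zeros b w q k : 1 <= b ->
  (forall j, (j < q)%N -> w j = 0%N) ->
  word_value b w k <= word_value b (fun j => w (q + j)%N) (k - q).
Proof.
move=> b1 w0; have b0 : 0 <= b by exact: le_trans b1.
have [kq|/ltnW qk] := leqP k q.
  rewrite word_value_zeros ?word_value_ge0 // => j jk.
  by rewrite w0 // (leq_trans jk).
rewrite -{1}(subnKC qk) word_value_cat word_value_zeros // add0r.
rewrite ler_piMr ?word_value_ge0 // invf_le1 ?exprn_ege1 //.
by rewrite exprn_gt0 // (lt_le_trans _ b1).
Qed.

Lemma word_valueS b w k : b != 0 -> b * word_value b w k.+1 =
  (w 0%N)%:R + word_value b (fun j => w j.+1) k.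
Proof.
by move=> b0; rewrite -add1n word_value_cat word_value1 expr1; field.
Qed.

(** The sum telescopes, since w_n = b y_n - y_(n+1). This serves both the greedy orbits and
    [orbit1]. *)
Lemma word_value_orbit b w y k : b != 0 ->
  (forall n, y n.+1 = b * y n - (w n)%:R) -> word_value b w k = y 0%N - y k / b ^+ k.
Proof.
move=> b0 yS; elim: k => [|k IH].
  by rewrite /word_value big_ord0 expr0 divr1 subrr.
rewrite -addn1 word_value_cat IH word_value1 addn1 addn0 yS exprS.
by field; rewrite expf_neq0.
Qed.

(** The orbit of [x] under the beta-transformation, multiplication by [b] modulo 1. *)
Definition greedy_orbit b x n : R :=
  iter n (fun c => b * c - (Num.floor (b * c))%:~R) x.

Definition greedy_digit b x n : nat := `|Num.floor (b * greedy_orbit b x n)|%N.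

Lemma greedy_orbit_add b x m n :
  greedy_orbit b x (m + n) = greedy_orbit b (greedy_orbit b x m) n.
Proof. by rewrite /greedy_orbit addnC iterD. Qed.

Section Greedy.
Variables (b x : R).
Hypotheses (b1 : 1 < b) (x01 : 0 <= x < 1).

Let b0 : 0 < b. Proof. exact: lt_trans b1. Qed.

Lemma greedy_orbit_itv n : 0 <= greedy_orbit b x n < 1.
Proof.
case: n => [|n]; first exact: x01.
have := floor_itv (b * greedy_orbit b x n); rewrite /greedy_orbit iterS.
by rewrite intrD => /andP[? ?]; apply/andP; split; lra.
Qed.

Lemma greedy_digitE n :
  (greedy_digit b x n)%:R = (Num.floor (b * greedy_orbit b x n))%:~R :> R.
Proof.
rewrite natr_absz ger0_norm // floor_ge0 mulr_ge0 ?(ltW b0) //.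
by case/andP: (greedy_orbit_itv n).
Qed.

Lemma greedy_orbitS n :
  greedy_orbit b x n.+1 = b * greedy_orbit b x n - (greedy_digit b x n)%:R.
Proof. by rewrite greedy_digitE. Qed.

Lemma greedy_digit_lt n : (greedy_digit b x n < `|Num.ceil b|)%N.
Proof.
have cb : 0 <= Num.ceil b by rewrite ceil_ge0 (lt_trans _ b0).
rewrite -(ltr_nat R) natr_absz ger0_norm // greedy_digitE.
apply: le_lt_trans (lt_le_trans _ (ceil_ge b)); first exact: Num.Theory.floor_le.
by rewrite gtr_pMr //; case/andP: (greedy_orbit_itv n).
Qed.

Lemma greedy_word_value n :
  word_value b (greedy_digit b x) n = x - greedy_orbit b x n / b ^+ n.
Proof. by rewrite (word_value_orbit _ (lt0r_neq0 b0) greedy_orbitS). Qed.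

End Greedy.

(** A tail of a greedy expansion is the greedy expansion of an iterate, which is less than 1 and
    bounds its partial sums. *)
Lemma greedy_word_value_lt1 b x m k : 1 < b -> 0 <= x < 1 ->
  word_value b (fun j => greedy_digit b x (m + j)) k < 1.
Proof.
move=> b1 x01; have y01 := greedy_orbit_itv b x01 m.
rewrite (@word_value_eq _ _ (greedy_digit b (greedy_orbit b x m))).
  rewrite greedy_word_value //.
  have /andP[] := greedy_orbit_itv b y01 k => ? ?.
  have : 0 <= greedy_orbit b (greedy_orbit b x m) k / b ^+ k.
    by rewrite divr_ge0 // exprn_ge0 // ltW // (lt_trans _ b1).
  by case/andP: y01; lra.
by move=> j _; rewrite /greedy_digit greedy_orbit_add.
Qed.

(** The greedy orbit of the value of [w] runs through the values of its suffixes: when these are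
    less than 1, each floor reads off the next letter. *)
Lemma greedy_digit_word b w k : 1 < b ->
  (forall m, (m <= k)%N -> word_value b (fun j => w (m + j)%N) (k - m) < 1) ->
  forall m, (m < k)%N -> greedy_digit b (word_value b w k) m = w m.
Proof.
move=> b1 wlt; have b0 : 0 < b by exact: lt_trans b1.
have fl m : (m < k)%N ->
    Num.floor (b * word_value b (fun j => w (m + j)%N) (k - m)) = (w m)%:Z.
  move=> mk; rewrite -(subSS m) subSn // word_valueS ?gt_eqF // addn0.
  apply: floor_def; rewrite intrD !pmulrn.
  have := wlt _ mk; have := word_value_ge0 (fun j => w (m.+1 + j)%N) (k - m.+1) (ltW b0).
  rewrite (@word_value_eq _ (fun j => w (m + j.+1)%N) (fun j => w (m.+1 + j)%N)).
    by move=> ? ?; apply/andP; split; lra.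
  by move=> j _; rewrite addnS.
have orb m : (m <= k)%N -> greedy_orbit b (word_value b w k) m =
    word_value b (fun j => w (m + j)%N) (k - m).
  elim: m => [_|m IH mk]; first by rewrite subn0.
  rewrite /greedy_orbit iterS -/(greedy_orbit _ _ _) IH ?(ltnW mk) // fl //.
  rewrite -(subSS m) subSn // word_valueS ?gt_eqF // addn0 pmulrn addrAC subrr add0r.
  by apply: word_value_eq => j _; rewrite addnS.
by move=> m mk; rewrite /greedy_digit orb ?(ltnW mk) // fl.
Qed.

End Words.

(** * Cylinders as neighbourhoods in sequence spaces *)

Section Cylinders.
Context (I : eqType) (D : discreteTopologicalType).

Lemma near_ptws_eq1 (z : {ptws I -> D}) i : \forall y \near z, y i = z i.
Proof.
exact: (@proj_continuous I (fun=> D) i z _ (discrete_set1 (z i))).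
Qed.

Lemma near_ptws_eq (z : {ptws I -> D}) (u : nat -> I) k :
  \forall y \near z, forall m, (m < k)%N -> y (u m) = z (u m).
Proof.
have zF : Filter (nbhs z) by exact: nbhs_filter.
elim: k => [|k IH]; first by near=> y.
near=> y; move=> m; rewrite ltnS leq_eqVlt => /predU1P[->|].
  by near: y; exact: near_ptws_eq1.
by move: m; near: y; exact: IH.
Unshelve. all: by end_near. Qed.

Lemma continuous_near_eq (X : topologicalType) (f : X -> {ptws I -> D}) x i :
  {for x, continuous f} -> \forall y \near x, f y i = f x i.
Proof. by move=> fx; have := fx _ (near_ptws_eq1 (f x) i). Qed.

End Cylinders.

(** * The words of the beta-shift, and its compactness *)

Section BetaShiftWords.
Context {R : realType}.
Implicit Types b x : R.

Definition block b (x : two_sided_seq b) (i : int) (m : nat) : nat :=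
  nat_of_ord (x (i + m%:Z)).

Section Base.
Variable b : R.
Hypothesis b1 : 1 < b.

Let b0 : 0 < b. Proof. exact: lt_trans b1. Qed.

Lemma alphabet_size_gt1 : (1 < `|Num.ceil b|)%N.
Proof.
have c1 : 1 < Num.ceil b by rewrite ceil_gt_int.
by lia.
Qed.

Definition mk_digit (n : nat) : digit b :=
  insubd (Ordinal (ltnW alphabet_size_gt1)) n.

Lemma mk_digitK n : (n < `|Num.ceil b|)%N -> nat_of_ord (mk_digit n) = n.
Proof. by move=> nb; rewrite /mk_digit val_insubd nb. Qed.

Definition greedy_seq x : one_sided_seq b := fun n => mk_digit (greedy_digit b x n).

Lemma greedy_seqE x n : 0 <= x < 1 ->
  nat_of_ord (greedy_seq x n) = greedy_digit b x n.
Proof. by move=> x01; rewrite mk_digitK // greedy_digit_lt. Qed.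

Lemma series_word_value (s : one_sided_seq b) n :
  series (fun n => (nat_of_ord (s n))%:R / b ^+ n.+1) n =
    word_value b (fun n => nat_of_ord (s n)) n :> R.
Proof. by rewrite /series /= big_mkord. Qed.

Lemma expansion_greedy_seq x : 0 <= x < 1 -> expansion x (greedy_seq x).
Proof.
move=> x01; rewrite /expansion.
have -> : series (fun n => (nat_of_ord (greedy_seq x n))%:R / b ^+ n.+1) =
    (fun n => x - greedy_orbit b x n / b ^+ n).
  apply/funext => n; rewrite series_word_value -greedy_word_value //.
  by apply: word_value_eq => j _; rewrite greedy_seqE.
rewrite -[X in _ --> X]subr0; apply: cvgB; first exact: cvg_cst.
have bV : `|b^-1| < 1 by rewrite gtr0_norm ?invr_gt0 // invf_lt1.
apply: squeeze_cvgr (cvg_cst 0) (cvg_geometric 1 bV).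
near=> n => /=; have /andP[y0 y1] := greedy_orbit_itv b x01 n.
rewrite exprVn mul1r divr_ge0 ?exprn_ge0 ?(ltW b0) //=.
by rewrite ler_piMl ?invr_ge0 ?exprn_ge0 ?(ltW b0) // ltW.
Unshelve. all: by end_near. Qed.

Lemma expansion_word_value_le x (s : one_sided_seq b) n : expansion x s ->
  word_value b (fun n => nat_of_ord (s n)) n <= x.
Proof.
move=> sx; rewrite -series_word_value.
have nd : nondecreasing_seq (series (fun n => (nat_of_ord (s n))%:R / b ^+ n.+1 : R)).
  by move=> m k mk; rewrite !series_word_value word_value_le // ltW.
rewrite -(cvg_lim _ sx) //; apply: nondecreasing_cvgn_le => //.
by apply/cvg_ex; exists x.
Qed.

Lemma seq_first_diff (s t : one_sided_seq b) : s <> t ->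
  exists2 n, forall i, (i < n)%N -> s i = t i & s n <> t n.
Proof.
move=> st; have ex : exists n, s n != t n.
  apply: contrapT => /forallNP H; apply: st; apply/funext => n.
  by apply/eqP; rewrite -[_ == _]negbK; apply/negP; exact: H.
case: (ex_minnP ex) => n /eqP sn nmin; exists n => // i ni.
by apply/eqP; apply: contraTT ni => /nmin; rewrite -leqNgt.
Qed.

(** Up to the first difference the prefixes have equal value. The next digit of [t] is then at most
    [b] times the greedy iterate, hence at most its floor, the greedy digit. *)
Lemma lex_lt_greedy_seq x (t : one_sided_seq b) : 0 <= x < 1 -> expansion x t ->
  t = greedy_seq x \/ lex_lt t (greedy_seq x).
Proof.
move=> x01 tx; have [|tg] := pselect (t = greedy_seq x); [by left|right].
have [n teq tn] := seq_first_diff tg; exists n => //.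
rewrite ltn_neqAle; apply/andP; split; first by apply/eqP => /ord_inj.
have := expansion_word_value_le n.+1 tx.
rewrite -addn1 word_value_cat word_value1 addn0.
rewrite (@word_value_eq _ _ _ (greedy_digit b x)); last first.
  by move=> j jn; rewrite teq // greedy_seqE.
rewrite greedy_word_value // greedy_seqE // -[X in _ <= X]addr0 -addrA lerD2l.
rewrite addrC subr_le0 ler_pM2r ?invr_gt0 ?exprn_gt0 // ler_pdivrMr // mulrC => tle.
rewrite -ltnS -(ltr_nat R) -[X in _ < X]natr1 greedy_digitE //.
by apply: le_lt_trans tle _; rewrite -(intrD _ _ 1) floorD1_gt.
Qed.

Lemma lex_lt_asym (s t : one_sided_seq b) : lex_lt s t -> ~ lex_lt t s.
Proof.
move=> [n stn sn] [m tsm tm].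
have [nm|mn|nm] := ltngtP n m.
- by move: sn; rewrite (tsm _ nm) ltnn.
- by move: tm; rewrite (stn _ mn) ltnn.
- by rewrite nm in sn; have := ltn_trans sn tm; rewrite ltnn.
Qed.

Lemma d_betaE x (s : one_sided_seq b) : 0 <= x < 1 ->
  d_beta x s <-> s = greedy_seq x.
Proof.
move=> x01; split => [[sx smax]|->]; last first.
  by split; [exact: expansion_greedy_seq | move=> t; exact: lex_lt_greedy_seq].
have [//|sg] := lex_lt_greedy_seq x01 sx.
have [//|gs] := smax _ (expansion_greedy_seq x01).
by case: (lex_lt_asym sg gs).
Qed.

(** Words of the closure already occur in greedy expansions. Conversely, a word all of whose
    suffixes have value less than 1 begins the greedy expansion of its own value. *)
Lemma two_sided_beta_shiftP (x : two_sided_seq b) :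
  two_sided_beta_shift b x <-> forall i k, word_value b (block x i) k < 1.
Proof.
split => [Xx i k|xlt i k].
  have [s Ss [j sj]] := Xx i k.
  have [t [[y y01 /(d_betaE _ y01) ->]] /= ts] := Ss _ (near_ptws_eq s id (j + k)).
  rewrite (@word_value_eq _ _ _ (fun m => greedy_digit b y (j + m))).
    exact: greedy_word_value_lt1.
  by move=> m mk; rewrite /block sj // -ts ?ltn_add2l // greedy_seqE.
have x01 : 0 <= word_value b (block x i) k < 1.
  by rewrite xlt word_value_ge0 // ltW.
exists (greedy_seq (word_value b (block x i) k)).
  by apply: subset_closure; exists (word_value b (block x i) k) => //; exact/d_betaE.
exists 0%N => m mk; apply: ord_inj; rewrite add0n greedy_seqE //.
rewrite greedy_digit_word // => n nk.
rewrite (@word_value_eq _ _ _ (block x (i + n%:Z))) //.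
by move=> j _; rewrite /block PoszD addrA.
Qed.

Lemma two_sided_beta_shift_closed : closed (two_sided_beta_shift b).
Proof.
move=> x clx i k; have [y [Xy /= yx]] := clx _ (near_ptws_eq x (fun m : nat => i + m%:Z) k).
have [s Ss [j sj]] := Xy i k; exists s => //; exists j => m mk.
by rewrite -yx // sj.
Qed.

Lemma two_sided_beta_shift_compact : compact (two_sided_beta_shift b).
Proof.
apply: (subclosed_compact two_sided_beta_shift_closed (B := setT)) => //.
have -> : [set: two_sided_seq b] = [set f | forall i : int, [set: digit b] (f i)].
  by apply/seteqP; split.
apply: (@tychonoff int (fun=> digit b) (fun=> setT)) => i.
by apply: finite_compact; exact: (@finite_finset 'I_(`|Num.ceil b|%N)).
Qed.

End Base.
End BetaShiftWords.

Lemma compact_set_type (X : topologicalType) (A : set X) :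
  compact A -> compact [set: A].
Proof.
move=> cA F FF _; have FFA : (set_val @ F) A.
  apply: (@filterS _ F _ setT) => [a _|]; [exact: set_valP|exact: filterT].
have [p [Ap clp]] := cA _ (fmap_proper_filter set_val FF) FFA.
exists (SigSub (mem_set Ap)); split => // U V FU; rewrite nbhsE => -[B [[W oW WB] Bp] BV].
have FU' : (set_val @ F) (set_val @` U).
  exact: filterS (@preimage_image _ _ set_val U) FU.
have Wp : W p by move: Bp; rewrite -WB.
have [_ [[u Uu <-] Wu]] := clp _ _ FU' (open_nbhs_nbhs (conj oW Wp)).
by exists u; split => //; apply: BV; rewrite -WB.
Qed.

(** * Block codes, and the asymmetry between past and future *)

Section Dynamics.
Context {R : realType}.
Variable b : R.
Hypothesis b1 : 1 < b.

Let b0 : 0 < b. Proof. exact: lt_trans b1. Qed.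
Local Notation X := (two_sided_beta_shift b).
Implicit Types x y z : X.

Lemma val_translate d x i : val (translate d x) i = val x (i + d).
Proof. by []. Qed.

(** The compactness argument of Curtis, Hedlund and Lyndon. Taking the inclusion and a conjugacy for
    [f] and [g], in either order, gives the codes of the conjugacy and of its inverse. *)
Lemma uniform_window (f g : X -> two_sided_seq b) :
  continuous f -> continuous g -> (forall x y, f x = f y -> g x = g y) ->
  exists r : nat, forall x y,
    (forall i : int, (`|i| <= r)%N -> f x i = f y i) -> g x 0 = g y 0.
Proof.
move=> cf cg fg.
have cX : compact [set: X] by apply: compact_set_type; exact: two_sided_beta_shift_compact.
pose P (n : nat) (z : X * X) :=
  (forall i : int, (`|i| <= n)%N -> f z.1 i = f z.2 i) -> g z.1 0 = g z.2 0.
have c1 h : continuous h -> continuous (fun z : X * X => h z.1 : two_sided_seq b).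
  by move=> ch u; apply: continuous_comp; [exact: cvg_fst|exact: ch].
have c2 h : continuous h -> continuous (fun z : X * X => h z.2 : two_sided_seq b).
  by move=> ch u; apply: continuous_comp; [exact: cvg_snd|exact: ch].
(* If the images under [f] agree, coordinate 0 of [g] is locally constant and equal on both sides.
   If not, a differing coordinate [j] persists nearby and refutes the premise once [n] is at least
   |j|. *)
have cover (z : X * X) : \forall u \near z & n \near \oo, P n u.
  have [fz|fz] := pselect (f z.1 = f z.2).
    near=> u n => _.
    have -> : g u.1 0 = g z.1 0.
      by near: u; exact: (continuous_near_eq 0 (c1 _ cg z)).
    have -> : g u.2 0 = g z.2 0.
      by near: u; exact: (continuous_near_eq 0 (c2 _ cg z)).
    by rewrite (fg _ _ fz).
  have [j fj] : exists j, f z.1 j <> f z.2 j.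
    by apply: contrapT => /forallNP H; apply: fz; apply/funext => j; apply: contrapT.
  near=> u n.
  have nj : (`|j| <= n)%N by near: n; exact: nbhs_infty_ge.
  move=> /(_ j nj) fu.
  exfalso; apply: fj.
  have <- : f u.1 j = f z.1 j.
    by near: u; exact: (continuous_near_eq j (c1 _ cf z)).
  have <- : f u.2 j = f z.2 j.
    by near: u; exact: (continuous_near_eq j (c2 _ cf z)).
  exact: fu.
have cXX : compact [set: X * X] by rewrite -setXTT; exact: compact_setX.
have /compact_near_coveringP nc := cXX.
have [r _ H] : \forall n \near \oo, [set: X * X] `<=` P n.
  by apply: nc => z _; exact: cover.
by exists r => x y xy; exact: (H r (leqnn r) (x, y)).
Unshelve. all: by end_near. Qed.

Lemma determined_future (M : nat) :
  (forall d, 0 < d -> exists n, orbit1 b n < d) ->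
  exists x, forall y, (forall i, i < 0 -> val y i = val x i) ->
    forall i, i < M%:Z -> val y i = val x i.
Proof.
move=> small; have [n nM] := small (b ^- M) ltac:(by rewrite invr_gt0 exprn_gt0).
pose e m : nat := `|digit1 b m|%N.
have eE m : (e m)%:R = (digit1 b m)%:~R :> R.
  rewrite /e natr_absz ger0_norm // /digit1 subr_ge0 -gtz0_ge1 ceil_gt0 mulr_gt0 //.
  by case/andP: (orbit1_itv b m).
have e_lt m : (e m < `|Num.ceil b|)%N.
  have cb : 0 <= Num.ceil b by rewrite ceil_ge0 (lt_trans _ b0).
  rewrite -(ltr_nat R) natr_absz ger0_norm // eE ltr_int /digit1 ltrBlDr ltzD1.
  by apply: ceil_le; rewrite ler_piMr ?(ltW b0) //; case/andP: (orbit1_itv b m).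
have e_value m k : word_value b (fun j => e (m + j)%N) k =
    orbit1 b m - orbit1 b (m + k) / b ^+ k.
  rewrite (@word_value_orbit _ _ _ (fun k => orbit1 b (m + k))) ?gt_eqF ?addn0 //.
  by move=> j; rewrite addnS orbit1S eE.
(* Zeros, then the whole quasi-greedy expansion starting at position [- n], so that the past ends
   with its first [n] digits. *)
pose s : two_sided_seq b := fun i =>
  mk_digit b1 (if (i + n%:Z)%R is Posz m then e m else 0%N).
have e_value_lt1 m k : word_value b (fun j => e (m + j)%N) k < 1.
  rewrite e_value; have /andP[_ c1] := orbit1_itv b m.
  have /andP[c0 _] := orbit1_itv b (m + k).
  have : 0 < orbit1 b (m + k) / b ^+ k by rewrite divr_gt0 ?exprn_gt0.
  lra.
have sE i : nat_of_ord (s i) = if (i + n%:Z)%R is Posz m then e m else 0%N.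
  rewrite mk_digitK //; case: (i + n%:Z) => // ?.
  by rewrite ltnW // alphabet_size_gt1.
have Xs : two_sided_beta_shift b s.
  apply/(two_sided_beta_shiftP b1) => i k.
  case: (leP 0 (i + n%:Z)) => [i0|i0].
    rewrite (@word_value_eq _ _ _ (fun j => e (`|(i + n%:Z)%R| + j)%N)) // => j _.
    rewrite /block sE; have -> : i + j%:Z + n%:Z = Posz (`|(i + n%:Z)%R| + j)%N by lia.
    by [].
  apply: le_lt_trans (e_value_lt1 0%N (k - `|(i + n%:Z)%R|)%N).
  apply: (le_trans (word_value_drop_zeros (q := `|(i + n%:Z)%R|%N) k (ltW b1) _)).
    by move=> j ji; rewrite /block sE; case E : (_ + _) => [m|//]; lia.
  rewrite (@word_value_eq _ _ _ (fun j => e (0 + j)%N)) // => j _.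
  by rewrite /block sE; have -> : i + (`|(i + n%:Z)%R| + j)%N%:Z + n%:Z = Posz j by lia.
have key (y : X) : (forall i, i < 0 -> val y i = s i) ->
    forall j : nat, (j < M)%N -> nat_of_ord (val y j%:Z) = 0%N.
  move=> ys j jM.
  (* The first [n] digits have value 1 - c_n / b^n, leaving less than c_n < b^-M for the rest; a
     nonzero digit at [j] < [M] costs at least b^-M. *)
  have := (two_sided_beta_shiftP b1 _).1 (set_valP y) (- n%:Z) (n + j.+1)%N.
  rewrite word_value_cat (@word_value_eq _ _ _ e); last first.
    move=> m mn; rewrite /block ys ?sE; last lia.
    by have -> : - n%:Z + m%:Z + n%:Z = m by lia.
  rewrite (e_value 0%N) add0n [orbit1 b 0]/(1 : R) -addrA gtrDl addrC subr_lt0.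
  rewrite ltr_pM2r ?invr_gt0 ?exprn_gt0 // -addn1 word_value_cat word_value1 addn0.
  have := word_value_ge0 (fun m => block (val y) (- n%:Z) (n + m)) j (ltW b0).
  rewrite /block (_ : - n%:Z + (n + j)%N%:Z = j%:Z); last lia.
  set v := word_value _ _ _; set d := nat_of_ord _ => v0 vd.
  have dM : d%:R / b / b ^+ j < b ^- M by lra.
  apply/eqP; rewrite -leqn0 -ltnS -(ltr_nat R).
  move: dM; rewrite -mulrA -invfM -exprS ltr_pdivrMr ?exprn_gt0 //.
  move=> /lt_le_trans; apply.
  by rewrite mulrC ler_pdivrMr ?exprn_gt0 // mul1r ler_weXn2l // ltW.
exists (SigSub (mem_set Xs)) => y ys i iM.
have [/ys //|i0] := ltP i 0.
have [j ij] : exists j : nat, i = j%:Z by exists `|i|%N; lia.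
rewrite ij; apply: ord_inj; rewrite (key y) //; last lia.
by rewrite (key (SigSub (mem_set Xs))) //; lia.
Qed.

Lemma undetermined_past : exists L : nat, forall x (m : int), exists y,
  (forall i, m <= i -> val y i = val x i) /\
  exists2 p, m - L%:Z <= p < m & val y p <> val x p.
Proof.
(* This [L] gives b^-1 + b^-L < 1, so that 1 0^(L-1) may precede any word of value less than 1. *)
have [L] := expr_unbounded (b / (b - 1)) b1.
rewrite ltr_pdivrMr ?subr_gt0 // => bL.
have L0 : (0 < L)%N by rewrite lt0n; apply/eqP => L0; move: bL; rewrite L0 expr0; lra.
exists L => x m.
(* The new past is zero except for [c] at [m - L]; of 0 and 1, at least one differs from the digit
   of [x] there. *)
have [c c1 cx] : exists2 c : nat, (c <= 1)%N & mk_digit b1 c <> val x (m - L%:Z).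
  have [x0|] := pselect (mk_digit b1 0 = val x (m - L%:Z)); last by exists 0%N.
  exists 1%N => // x1; have := congr1 (@nat_of_ord _) (etrans x1 (esym x0)).
  by rewrite !mk_digitK // ?alphabet_size_gt1 // ltnW // alphabet_size_gt1.
pose s : two_sided_seq b := fun i => if m <= i then val x i
  else mk_digit b1 (if i == (m - L%:Z)%R then c else 0%N).
have sx i : m <= i -> s i = val x i by rewrite /s => ->.
have s0 i : i < m -> i != m - L%:Z -> nat_of_ord (s i) = 0%N.
  rewrite /s ltNge => /negPf -> /negPf ->.
  by rewrite mk_digitK // ltnW // alphabet_size_gt1.
have sc : nat_of_ord (s (m - L%:Z)) = c.
  rewrite /s eqxx ifF; last lia.
  by rewrite mk_digitK // (leq_ltn_trans c1) // alphabet_size_gt1.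
have Vx i k : word_value b (block (val x) i) k < 1.
  exact: ((two_sided_beta_shiftP b1 _).1 (set_valP x)).
have V1 k : word_value b (block s m) k < 1.
  rewrite (@word_value_eq _ _ _ (block (val x) m)) // => j _.
  by rewrite /block sx //; lia.
(* Leading zeros reduce every word starting before [m] to one starting at [m - L] or at [m]. *)
have drop i (q : nat) k : i + q%:Z <= m -> (i + q%:Z <= m - L%:Z) || (m - L%:Z < i) ->
    word_value b (block s i) k <= word_value b (block s (i + q%:Z)) (k - q).
  move=> iqm iq; apply: le_trans (word_value_drop_zeros (q := q) k (ltW b1) _) _.
    by move=> j jq; rewrite /block s0 //; lia.
  rewrite (@word_value_eq _ _ _ (block s (i + q%:Z))) // => j _.
  by rewrite /block PoszD addrA.
have VL k : word_value b (block s (m - L%:Z)) k < 1.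
  apply: le_lt_trans (word_value_le _ (ltW b0) (leq_addl L k)) _.
  rewrite word_value_cat.
  rewrite (@word_value_eq _ _ (fun j => block s _ (L + j)%N) (block s m)); last first.
    by move=> j _; rewrite /block; congr (nat_of_ord (s _)); lia.
  rewrite -[X in word_value _ _ X + _](prednK L0) -[X in word_value _ _ X + _]add1n.
  rewrite word_value_cat word_value1.
  rewrite word_value_zeros ?mul0r ?addr0; last first.
    by move=> j jL; rewrite /block s0 //; lia.
  rewrite /block addr0 sc.
  have cb : c%:R / b <= b^-1.
    by rewrite ler_piMl ?invr_ge0 ?(ltW b0) // -[1]/(1%:R) ler_nat.
  have bL0 : 0 < b ^+ L by exact: exprn_gt0.
  have : word_value b (block s m) k / b ^+ L < (b ^+ L)^-1.
    by rewrite gtr_pMl ?invr_gt0.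
  have : (b ^+ L)^-1 <= 1 - b^-1.
    have -> : 1 - b^-1 = (b - 1) / b by field; rewrite gt_eqF.
    by rewrite ler_pdivlMr // mulrC ler_pdivrMr // mulrC ltW.
  rewrite /block; lra.
have Xs : two_sided_beta_shift b s.
  apply/(two_sided_beta_shiftP b1) => i k.
  have [mi|im] := leP m i.
    rewrite (@word_value_eq _ _ _ (block (val x) i)) // => j _.
    by rewrite /block sx //; lia.
  have [iL|Li] := leP i (m - L%:Z).
    apply: le_lt_trans (drop i `|(m - L%:Z - i)%R|%N k _ _) _; try lia.
    by have -> : i + `|(m - L%:Z - i)%R|%N%:Z = m - L%:Z by lia.
  apply: le_lt_trans (drop i `|(m - i)%R|%N k _ _) _; try lia.
  by have -> : i + `|(m - i)%R|%N%:Z = m by lia.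
exists (SigSub (mem_set Xs)); split => [i|]; first exact: sx.
exists (m - L%:Z); first lia.
rewrite /= /s eqxx ifF //; lia.
Qed.

Lemma conjugacy_translate (phi : X -> X) (d : int) x :
  sigma_inv b \o phi = phi \o sigma b ->
  phi (translate d x) = translate (- d) (phi x).
Proof.
move=> conj.
have trD (c d' : int) (y : X) : translate c (translate d' y) = translate (c + d') y.
  by apply/val_inj/funext => i /=; rewrite addrA.
have tr0 (y : X) : translate 0 y = y by apply/val_inj/funext => i /=; rewrite addr0.
have nat_case (n : nat) (y : X) : phi (translate n y) = translate (- n%:Z) (phi y).
  elim: n y => [|n IH] y; first by rewrite oppr0 !tr0.
  have := congr1 (@^~ (translate n%:Z y)) conj; rewrite /= /sigma /sigma_inv trD IH trD.
  by rewrite -intS => <-; congr translate; lia.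
case: d => n; first exact: nat_case.
rewrite NegzE opprK -[in RHS](tr0 x) -(subrr n.+1%:Z) -trD nat_case trD subrr.
by rewrite tr0.
Qed.

Lemma not_conjugate_sigma_inv : (forall d, 0 < d -> exists n, orbit1 b n < d) ->
  ~ conjugate (sigma b) (sigma_inv b).
Proof.
move=> small [phi [cphi bphi conj]].
have tr := conjugacy_translate _ _ conj.
have [phi' phiK phi'K] := bphi.
have cv : continuous (set_val : X -> two_sided_seq b) by exact: initial_continuous.
have cvp : continuous (set_val \o phi : X -> two_sided_seq b).
  by move=> x; apply: continuous_comp; [exact: cphi|exact: cv].
have [r1 H1] : exists r : nat, forall x y,
    (forall i : int, (`|i| <= r)%N -> val x i = val y i) -> val (phi x) 0 = val (phi y) 0.
  by apply: (uniform_window cv cvp) => x y /val_inj /= ->.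
have [r2 H2] : exists r : nat, forall x y,
    (forall i : int, (`|i| <= r)%N -> val (phi x) i = val (phi y) i) -> val x 0 = val y 0.
  by apply: (uniform_window cvp cv) => x y /val_inj /(can_inj phiK) ->.
pose r := maxn r1 r2.
(* As [phi] reverses the shift, coordinate [j] of the image is read off around [- j]. *)
have code x y j : (forall i, `|i + j| <= r%:Z -> val x i = val y i) ->
    val (phi x) j = val (phi y) j.
  move=> xy; have E z : val (phi z) j = val (phi (translate (- j) z)) 0.
    by rewrite tr opprK val_translate add0r.
  rewrite !E; apply: H1 => i ir; rewrite !val_translate xy // addrNK; lia.
have decode x y j : (forall i, `|i - j| <= r%:Z -> val (phi x) i = val (phi y) i) ->
    val x (- j) = val y (- j).
  move=> xy; have E z : val z (- j) = val (translate (- j) z) 0.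
    by rewrite val_translate add0r.
  rewrite !E; apply: H2 => i ir; rewrite !tr opprK !val_translate xy //; lia.
have [L past] := undetermined_past.
(* Coordinate [p] >= 1 - r - L of an image is read up to r - p <= L + 2 r - 1, just inside the
   determined range. *)
have [x future] := determined_future (L + r.*2) small.
(* Decoding a coordinate [i'] <= -1 uses image coordinates from 1 - r on, where [z] agrees with
   [phi x]. So the preimage of [z] has the past of [x]. *)
have [z [zx [p pm zp]]] := past (phi x) (1 - r%:Z).
apply: zp; rewrite -(phi'K z); apply: code => i ip.
apply: future => [i' i'0|]; last lia.
rewrite -[i']opprK; apply: decode => k ki.
by rewrite phi'K zx //; lia.
Qed.

End Dynamics.

Theorem theorem4p1 (R : realType) :
  exists N : set R,
    [/\ N `<=` `]1, +oo[,
        meager N,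
        (@lebesgue_measure R).-negligible N
      & forall beta : R, 1 < beta -> ~ N beta ->
          ~ conjugate (sigma beta) (sigma_inv beta)].
Proof.
(* A positive infimum of the orbit is bounded below by some 1 / (m + 1), so countably many sets
   suffice. *)
pose A m := [set b : R | 1 < b /\ forall n, m.+1%:R^-1 <= orbit1 b n].
have small m : nowhere_dense (A m) /\ (@lebesgue_measure R).-negligible (A m).
  apply: orbit1_away_from_0_small; first by rewrite invr_gt0.
  by rewrite invf_le1 // ler1n.
exists (\bigcup_m A m); split.
- by move=> b [m _ [b1 _]]; rewrite /= in_itv /= b1.
- by exists A => // m; case: (small m).
- by apply: negligible_bigcup => m; case: (small m).
- move=> b b1 nA; apply: not_conjugate_sigma_inv => // d d0.
  apply: contrapT => /forallNP H; apply: nA.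
  have dV : 0 <= d^-1 by rewrite invr_ge0 ltW.
  exists (Num.bound d^-1) => //; split => // n.
  have dn : d <= orbit1 b n by rewrite leNgt; apply/negP; exact: H.
  apply: le_trans dn; rewrite invf_ple ?posrE // ltW // (lt_trans (archi_boundP dV)) //.
  by rewrite ltr_nat.
Qed.
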